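(* Let $A\in\mathbb{C}^{m\times n}$ and let $\mathcal{Z}\in\{0,1\}^{m\times n}$ be any fixed sparsity pattern. Let $X\in\mathbb{C}^{m\times n}$ be the minimizer of $J(\cdot\,;A)$ over all matrices $X\in\mathbb{C}^{m\times n}$ satisfying $\mathcal{N}(A)\subseteq\mathcal{N}(X)$, $\mathcal{N}(A^* )\subseteq\mathcal{N}(X^* )$, and $X_{ij}=0$ whenever $\mathcal{Z}_{ij}=0$, and let $J_{min}=J(X;A)$ be the minimum value. Then all the non-zero eigenvalues of $XA^\dagger$ and of $A^\dagger X$ lie within the circle of radius $\sqrt{2J_{min}}$ centered at $(1,0)$ in the complex plane, i.e. every non-zero eigenvalue $\lambda$ satisfies $|\lambda-1|\le\sqrt{2J_{min}}$.
   Context: $\mathcal{N}(\cdot)$ denotes the null-space, $^*$ the conjugate transpose, $^\dagger$ the Moore-Penrose pseudoinverse. The misfit functional is $J(X;A)=\tfrac12\|(X-A)A^\dagger\|_F^2+\tfrac12\|A^\dagger(X-A)\|_F^2$ with Frobenius norms. (The constrained minimizer exists and is unique.) *)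

(* Defs.v *)
From HB Require Import structures.
From mathcomp Require Import all_boot all_order all_algebra.
From mathcomp Require Export complex reals.

Set Implicit Arguments.
Unset Strict Implicit.
Unset Printing Implicit Defensive.

Import Order.TTheory GRing.Theory Num.Theory.
Local Open Scope ring_scope.
Local Open Scope sesquilinear_scope.

Section PseudoInverse.
Variable C : numClosedFieldType.

(* The four Penrose equations: B is the Moore-Penrose pseudoinverse of A. *)
Definition penrose m n (A : 'M[C]_(m, n)) (B : 'M[C]_(n, m)) : Prop :=
  [/\ A *m B *m A = A, B *m A *m B = B,
      (A *m B)^t* = A *m B & (B *m A)^t* = B *m A].

(* Computed from the full-rank factorization A = L *m U, with
   L = col_base A and U = row_base A; [mpinvmxP] and [penrose_uniq] show that
   this is the unique solution of the Penrose equations. It is unrelated to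
   MathComp's [pinvmx], which is only a one-sided partial inverse. *)
Definition mpinvmx m n (A : 'M[C]_(m, n)) : 'M[C]_(n, m) :=
  let L := col_base A in let U := row_base A in
  U^t* *m invmx (U *m U^t*) *m (invmx (L^t* *m L) *m L^t*).

Lemma ctrmxM m n p (A : 'M[C]_(m, n)) (B : 'M[C]_(n, p)) :
  (A *m B)^t* = B^t* *m A^t*.
Proof. by rewrite trmx_mul map_mxM. Qed.

Lemma ctrmx_inv n (A : 'M[C]_n) : (invmx A)^t* = invmx (A^t*).
Proof. by rewrite trmx_inv map_invmx. Qed.

Lemma mulmx_ctr_eq0 m n (A : 'M[C]_(m, n)) : A *m A^t* = 0 -> A = 0.
Proof.
move=> A0; apply/matrixP=> i j; rewrite mxE; apply/eqP.
have /eqP := congr1 (fun M : 'M_m => M i i) A0; rewrite !mxE psumr_eq0 => [|k _].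
  by move=> /allP/(_ j (mem_index_enum _)); rewrite !mxE -normCK sqrf_eq0 normr_eq0.
by rewrite !mxE -normCK exprn_ge0.
Qed.

Lemma unitmx_mul_ctr m n (U : 'M[C]_(m, n)) :
  row_free U -> U *m U^t* \in unitmx.
Proof.
move=> fU; rewrite -row_free_unit -kermx_eq0; apply/eqP.
set K := kermx _; have K0 : K *m (U *m U^t*) = 0 by apply: mulmx_ker.
have /mulmx_ctr_eq0 KU0 : (K *m U) *m (K *m U)^t* = 0.
  by rewrite ctrmxM !mulmxA -(mulmxA K) K0 mul0mx.
by apply: (row_free_inj fU); rewrite KU0 mul0mx.
Qed.

Lemma penrose_mul m r n (L : 'M[C]_(m, r)) (U : 'M[C]_(r, n)) :
  row_full L -> row_free U ->
  penrose (L *m U)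
    (U^t* *m invmx (U *m U^t*) *m (invmx (L^t* *m L) *m L^t*)).
Proof.
move=> fL fU.
have uU : U *m U^t* \in unitmx by exact: unitmx_mul_ctr.
have uL : L^t* *m L \in unitmx.
  have := @unitmx_mul_ctr _ _ (L^t*); rewrite trmxCK; apply.
  by rewrite /row_free mxrank_map mxrank_tr.
set P := invmx (U *m _); set Q := invmx (_ *m L).
have hP : P^t* = P by rewrite ctrmx_inv ctrmxM trmxCK.
have hQ : Q^t* = Q by rewrite ctrmx_inv ctrmxM trmxCK.
have UP : U *m (U^t* *m P) = 1%:M by rewrite mulmxA mulmxV.
have QL : Q *m (L^t* *m L) = 1%:M by rewrite mulVmx.
have AB : L *m U *m (U^t* *m P *m (Q *m L^t*)) = L *m Q *m L^t*.
  by rewrite -!mulmxA (mulmxA (U^t*)) (mulmxA U) UP mul1mx.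
have BA : U^t* *m P *m (Q *m L^t*) *m (L *m U) = U^t* *m P *m U.
  by rewrite -!mulmxA (mulmxA (L^t*)) (mulmxA Q) QL mul1mx.
split.
- by rewrite AB -!mulmxA (mulmxA (L^t*)) (mulmxA Q) QL mul1mx.
- by rewrite BA -!mulmxA (mulmxA (U^t*) P (Q *m _)) (mulmxA U) UP mul1mx !mulmxA.
- by rewrite AB !ctrmxM trmxCK hQ mulmxA.
- by rewrite BA !ctrmxM trmxCK hP mulmxA.
Qed.

Lemma mpinvmxP m n (A : 'M[C]_(m, n)) : penrose A (mpinvmx A).
Proof.
have := penrose_mul (col_base_full A) (row_base_free A).
by rewrite mulmx_base.
Qed.

Lemma penrose_uniq m n (A : 'M[C]_(m, n)) B1 B2 :
  penrose A B1 -> penrose A B2 -> B1 = B2.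
Proof.
move=> [a1 b1 c1 d1] [a2 b2 c2 d2].
have e1 : A *m B1 = A *m B2.
  by rewrite -c1 -{1}a2 -(mulmxA (A *m B2)) ctrmxM c1 c2 mulmxA a1.
have e2 : B1 *m A = B2 *m A.
  by rewrite -d1 -{1}a2 -(mulmxA A) mulmxA ctrmxM d1 d2 -mulmxA (mulmxA A) a1.
by rewrite -b1 e2 -mulmxA e1 mulmxA b2.
Qed.

End PseudoInverse.

Section Misfit.
Variable C : numClosedFieldType.

Definition frobnorm m n (A : 'M[C]_(m, n)) : C :=
  sqrtC (\sum_i \sum_j `|A i j| ^+ 2).

(* J(X; A). It is C-valued but real and nonnegative ([misfit_ge0]), so that
   the partial order of C restricted to its values is the usual order. *)
Definition misfit m n (X A : 'M[C]_(m, n)) : C :=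
  2^-1 * frobnorm ((X - A) *m mpinvmx A) ^+ 2
  + 2^-1 * frobnorm (mpinvmx A *m (X - A)) ^+ 2.

Lemma misfit_ge0 m n (X A : 'M[C]_(m, n)) : 0 <= misfit X A.
Proof.
have f0 p q (M : 'M[C]_(p, q)) : 0 <= frobnorm M.
  by rewrite sqrtC_ge0; do 2 apply: sumr_ge0 => ? _; rewrite exprn_ge0.
by rewrite addr_ge0 // mulr_ge0 ?invr_ge0 ?ler0n ?exprn_ge0.
Qed.

Definition nullspace_sub m p n (A : 'M[C]_(m, n)) (B : 'M[C]_(p, n)) : Prop :=
  forall v : 'cV[C]_n, A *m v = 0 -> B *m v = 0.

(* The sparsity pattern is a boolean matrix, with [false] for 0. *)
Definition feasible m n (A : 'M[C]_(m, n)) (Z : 'M[bool]_(m, n))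
    (X : 'M[C]_(m, n)) : Prop :=
  [/\ nullspace_sub A X, nullspace_sub (A^t*) (X^t*)
    & forall i j, Z i j = false -> X i j = 0].

Definition misfit_minimizer m n (A : 'M[C]_(m, n)) (Z : 'M[bool]_(m, n))
    (X : 'M[C]_(m, n)) : Prop :=
  feasible A Z X /\ forall Y, feasible A Z Y -> misfit X A <= misfit Y A.

End Misfit.

(* Main.v *)
Require Import Defs.
From mathcomp Require Import all_boot all_order all_algebra.
From mathcomp Require Import complex reals.
Import Order.TTheory GRing.Theory Num.Theory.
Local Open Scope ring_scope.
Local Open Scope complex_scope.

(** Write [P] for the pseudoinverse of [A]. The matrix [E := A *m P] satisfies
    [X *m P *m E = X *m P] by a Penrose equation, so a row eigenvector [v]
    of [X *m P] for an eigenvalue [lambda != 0], being a multiple of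
    [v *m (X *m P)], satisfies [v *m E = v]. Hence [v] is an eigenvector of
    [X *m P - E = (X - A) *m P] for [lambda - 1] ([eigenvalue_sub1]), and an
    eigenvalue is at most the Frobenius norm in absolute value
    ([eigenvalue_le_frobnorm], from Cauchy-Schwarz). That norm is in turn at most
    [sqrtC (2 * misfit X A)], as [2 * misfit X A] is the sum of its square and of
    another square.

    The same argument applies to [P *m X] with [E := P *m A]. There
    [P *m X *m E = P *m X] comes from the inclusion of the null-space of [A] in
    that of [X]: the columns of [1 - P *m A] lie in the former. *)

Section Frobenius.
Variable C : numClosedFieldType.
Local Open Scope sesquilinear_scope.

Lemma sqr_frobnorm m n (A : 'M[C]_(m, n)) :
  frobnorm A ^+ 2 = \sum_i \sum_j `|A i j| ^+ 2.
Proof. exact: sqrtCK. Qed.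

Lemma frobnorm_ge0 m n (A : 'M[C]_(m, n)) : 0 <= frobnorm A.
Proof.
by rewrite sqrtC_ge0; do 2 apply: sumr_ge0 => ? _; rewrite exprn_ge0.
Qed.

Lemma frobnorm_eq0 m n (A : 'M[C]_(m, n)) : frobnorm A = 0 -> A = 0.
Proof.
move=> A0; apply/matrixP=> i j; rewrite mxE; apply/eqP.
have row_ge0 k : 0 <= \sum_l `|A k l| ^+ 2.
  by apply: sumr_ge0 => l _; rewrite exprn_ge0.
have /eqP := sqr_frobnorm _ _ A; rewrite A0 expr0n eq_sym psumr_eq0 //.
move=> /allP/(_ i (mem_index_enum _)); rewrite psumr_eq0 => [|l _].
  by move=> /allP/(_ j (mem_index_enum _)); rewrite sqrf_eq0 normr_eq0.
by rewrite exprn_ge0.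
Qed.

Lemma frobnormZ m n a (A : 'M[C]_(m, n)) :
  frobnorm (a *: A) = `|a| * frobnorm A.
Proof.
apply/eqP; rewrite -(@eqrXn2 _ 2) ?mulr_ge0 ?frobnorm_ge0 //.
rewrite exprMn !sqr_frobnorm mulr_sumr; apply/eqP/eq_bigr => i _.
by rewrite mulr_sumr; apply: eq_bigr => j _; rewrite mxE normrM exprMn.
Qed.

Lemma dotmx_sqr n (u : 'rV[C]_n) : dotmx u u = \sum_k `|u 0 k| ^+ 2.
Proof. by rewrite dotmxE mxE; apply: eq_bigr => k _; rewrite !mxE normCK. Qed.

Lemma sqr_norm_dotmx_le n (u w : 'rV[C]_n) :
  `|dotmx u w| ^+ 2 <= dotmx u u * dotmx w w.
Proof. exact: (CauchySchwarz (@dotmx C n) u w).1. Qed.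

(** Each entry of the product is the Hermitian product of a row of [A] with the
    conjugate of a column of [B]; sum Cauchy-Schwarz over all the entries. *)
Lemma frobnormM m n p (A : 'M[C]_(m, n)) (B : 'M[C]_(n, p)) :
  frobnorm (A *m B) <= frobnorm A * frobnorm B.
Proof.
rewrite -(@ler_pXn2r _ 2) ?nnegrE ?mulr_ge0 ?frobnorm_ge0 //.
rewrite exprMn !sqr_frobnorm mulr_suml; apply: ler_sum => i _.
rewrite [X in _ * X]exchange_big mulr_sumr; apply: ler_sum => j _ /=.
have := sqr_norm_dotmx_le _ (row i A) ((col j B)^t*).
rewrite !dotmx_sqr dotmxE trmxCK.
have -> : (row i A *m col j B) 0 0 = (A *m B) i j.
  by rewrite !mxE; apply: eq_bigr => k _; rewrite !mxE.
congr (_ <= _ * _); apply: eq_bigr => k _; rewrite !mxE //.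
by rewrite norm_conjC.
Qed.

Lemma eigenvalue_le_frobnorm n (M : 'M[C]_n) a :
  eigenvalue M a -> `|a| <= frobnorm M.
Proof.
case/eigenvalueP=> v vM v0.
have v_gt0 : 0 < frobnorm v.
  by rewrite lt_def frobnorm_ge0 andbT; apply: contra_neq v0; apply: frobnorm_eq0.
by rewrite -(ler_pM2r v_gt0) -frobnormZ -vM mulrC frobnormM.
Qed.

End Frobenius.

(** The condition on [E] says that it acts as the identity on the row space of
    [M], which contains every eigenvector with a nonzero eigenvalue. *)
Lemma eigenvalue_sub1 (F : fieldType) n (M E : 'M[F]_n) a :
  M *m E = M -> a != 0 -> eigenvalue M a -> eigenvalue (M - E) (a - 1).
Proof.
move=> ME a0 /eigenvalueP[v vM v0]; apply/eigenvalueP; exists v => //.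
have vE : v *m E = v.
  by apply: (scalerI a0); rewrite -vM scalemxAl -vM -mulmxA ME.
by rewrite mulmxBr vM vE scalerBl scale1r.
Qed.

Lemma le_sqrtC (C : numClosedFieldType) (x y : C) :
  0 <= x -> x ^+ 2 <= y -> x <= sqrtC y.
Proof.
move=> x0 xy; have y0 : 0 <= y by apply: le_trans xy; rewrite exprn_ge0.
by rewrite -[leLHS]sqrCK // ler_sqrtC ?nnegrE ?exprn_ge0.
Qed.

Section Misfit.
Variables (C : numClosedFieldType) (m n : nat).
Implicit Types X A : 'M[C]_(m, n).

(** [1 - mpinvmx A *m A] is the projection onto the null-space of [A], hence is
    annihilated by [X]. *)
Lemma mulmx_mpinvmxK A X : nullspace_sub A X -> X *m mpinvmx A *m A = X.
Proof.
move=> AX; have [APA _ _ _] := mpinvmxP A.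
apply/eqP; rewrite -mulmxA -[X in _ == X]mulmx1 -subr_eq0 -mulmxBr; apply/eqP.
apply/matrixP=> i j; set D := _ - _.
have: X *m col j D = 0.
  by apply: AX; rewrite colE mulmxA mulmxBr mulmxA APA mulmx1 subrr mul0mx.
by rewrite colE mulmxA -colE => /matrixP/(_ i 0); rewrite !mxE.
Qed.

Lemma misfit2 X A :
  2 * misfit X A = frobnorm ((X - A) *m mpinvmx A) ^+ 2
                   + frobnorm (mpinvmx A *m (X - A)) ^+ 2.
Proof. by rewrite /misfit -mulrDr mulVKf ?pnatr_eq0. Qed.

Lemma frobnorm_subM_le X A :
  frobnorm ((X - A) *m mpinvmx A) <= sqrtC (2 * misfit X A).
Proof.
apply: le_sqrtC; first exact: frobnorm_ge0.
by rewrite misfit2 lerDl exprn_ge0 ?frobnorm_ge0.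
Qed.

Lemma frobnorm_Msub_le X A :
  frobnorm (mpinvmx A *m (X - A)) <= sqrtC (2 * misfit X A).
Proof.
apply: le_sqrtC; first exact: frobnorm_ge0.
by rewrite misfit2 lerDr exprn_ge0 ?frobnorm_ge0.
Qed.

End Misfit.

Theorem theorem4p7 (R : realType) (m n : nat) (A : 'M[R[i]]_(m, n))
    (Z : 'M[bool]_(m, n)) (X : 'M[R[i]]_(m, n))
    (hX : misfit_minimizer A Z X) :
  (forall lambda : R[i], lambda != 0 -> eigenvalue (X *m mpinvmx A) lambda ->
     `|lambda - 1| <= sqrtC (2 * misfit X A)) /\
  (forall lambda : R[i], lambda != 0 -> eigenvalue (mpinvmx A *m X) lambda ->
     `|lambda - 1| <= sqrtC (2 * misfit X A)).
Proof.
have [[AX _ _] _] := hX; have [_ PAP _ _] := mpinvmxP A.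
split=> lambda lambda0 ev.
- apply: le_trans (frobnorm_subM_le _ _ _ X A); apply: eigenvalue_le_frobnorm.
  rewrite mulmxBl; apply: eigenvalue_sub1 => //.
  by rewrite -mulmxA (mulmxA (mpinvmx A)) PAP.
- apply: le_trans (frobnorm_Msub_le _ _ _ X A); apply: eigenvalue_le_frobnorm.
  rewrite mulmxBr; apply: eigenvalue_sub1 => //.
  by rewrite -mulmxA (mulmxA X) mulmx_mpinvmxK.
Qed.
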